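(* Let $\mathsf{C}$ be an a.s.-compatibly representable Markov category with conditionals. Let $m \colon I \to \Theta$ be a morphism in $\mathsf{C}$, and let $f \colon \Theta \to X$ and $g \colon \Theta \to Y$ be two morphisms in $\mathsf{C}$, with standard experiments $\hat f, \hat g \colon \Theta \to P\Theta$ and standard measures $\hat f_m, \hat g_m \colon I \to P\Theta$ (with respect to $m$). Then the following are equivalent: 1. $f$ is $m$-a.s. more informative than $g$, i.e. there exists a morphism $c \colon X \to Y$ such that $c \circ f =_{m\text{-a.s.}} g$. 2. $\hat g_m$ second-order dominates $\hat f_m$, i.e. there exists a $\hat g_m$-dilation $t \colon P\Theta \to P\Theta$ such that $\hat f_m = t \circ \hat g_m$.
   Context: Coherence isomorphisms of monoidal categories are suppressed. A Markov category is a symmetric monoidal category $(\mathsf{C},\otimes,I)$ whose unit $I$ is terminal (write $\mathrm{del}_X \colon X \to I$), in which every object $X$ carries a distinguished morphism $\mathrm{copy}_X \colon X \to X\otimes X$ making $(X,\mathrm{copy}_X,\mathrm{del}_X)$ a commutative comonoid, and such that $\mathrm{copy}_{X\otimes Y} = (\mathrm{id}_X\otimes \mathrm{swap}_{X,Y}\otimes \mathrm{id}_Y)\circ(\mathrm{copy}_X\otimes \mathrm{copy}_Y)$. A morphism $f\colon X\to Y$ is deterministic if $\mathrm{copy}_Y\circ f=(f\otimes f)\circ \mathrm{copy}_X$; deterministic morphisms form a subcategory $\mathsf{C}_{\det}$. Conditionals: a conditional of $f\colon A\to X\otimes Y$ with respect to $X$ is a morphism $f_{|X}\colon X\otimes A\to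 Y$ with $f=(\mathrm{id}_X\otimes f_{|X})\circ(\mathrm{copy}_X\otimes \mathrm{id}_A)\circ(((\mathrm{id}_X\otimes \mathrm{del}_Y)\circ f)\otimes \mathrm{id}_A)\circ \mathrm{copy}_A$. $\mathsf{C}$ has conditionals if these exist for all such $f$. Bayesian inverse of $f\colon \Theta\to X$ with respect to $m\colon I\to \Theta$: a morphism $f^\dagger\colon X\to \Theta$ with $(f\otimes \mathrm{id}_\Theta)\circ \mathrm{copy}_\Theta\circ m=(\mathrm{id}_X\otimes f^\dagger)\circ \mathrm{copy}_X\circ f\circ m$. Almost sure equality: for $h\colon A\to X$ and $f,g\colon X\to Y$, write $f=_{h\text{-a.s.}}g$ if $(\mathrm{id}_X\otimes f)\circ \mathrm{copy}_X\circ h=(\mathrm{id}_X\otimes g)\circ \mathrm{copy}_X\circ h$. Representability: $\mathsf{C}$ is representable if every object $X$ has a distribution object, i.e. an object $PX$ with a morphism $\mathrm{samp}_X\colon PX\to X$ such that $\mathrm{samp}_X\circ -\colon \mathsf{C}_{\det}(A,PX)\to\mathsf{C}(A,X)$ is a bijection for all $A$. Its inverse is written $f\mapsto f^\sharp$. $P$ is a functor $\mathsf{C}\to\mathsf{C}_{\det}$, where for $f\colon X\to Y$, $Pf=(f\circ\mathrm{samp}_X)^\sharp$. $\mathsf{C}$ is a.s.-compatibly representable if it is representable and for all $p\colon B\to A$ and $f,g\colon A\to X$: $f^\sharp=_{p\text{-a.s.}}g^\sharp$ if and only if $f=_{p\text{-a.s.}}g$. Standard experiment and standard measure of $f\colon\Theta\to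 X$ (with respect to $m$): $\hat f:=(f^\dagger)^\sharp\circ f\colon\Theta\to P\Theta$, for a Bayesian inverse $f^\dagger$ of $f$ with respect to $m$ (unique up to $m$-a.s. equality), and $\hat f_m:=\hat f\circ m$. Dilation: for $q\colon I\to P\Theta$, a morphism $t\colon P\Theta\to P\Theta$ is a $q$-dilation (with respect to the free $P$-algebra structure $P(\mathrm{samp}_\Theta)\colon PP\Theta\to P\Theta$) if $P(\mathrm{samp}_\Theta)\circ t^\sharp=_{q\text{-a.s.}}\mathrm{id}_{P\Theta}$. *)

(* Defs.v *)
From mathcomp Require Import ssreflect.

Set Implicit Arguments.
Unset Strict Implicit.
Unset Printing Implicit Defensive.

Declare Scope ob_scope.
Delimit Scope ob_scope with ob.
Declare Scope hom_scope.
Delimit Scope hom_scope with hom.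

Reserved Notation "g ∘ f" (at level 40, left associativity).
Reserved Notation "f ⊗ g" (at level 38, left associativity).

Record category := Category {
  ob :> Type;
  hom : ob -> ob -> Type;
  idm : forall X, hom X X;
  compose : forall X Y Z, hom Y Z -> hom X Y -> hom X Z
    where "g ∘ f" := (compose g f);
  composeA : forall W X Y Z (h : hom Y Z) (g : hom X Y) (f : hom W X),
    h ∘ (g ∘ f) = (h ∘ g) ∘ f;
  compose1m : forall X Y (f : hom X Y), idm Y ∘ f = f;
  composem1 : forall X Y (f : hom X Y), f ∘ idm X = f
}.

Arguments hom {c}.
Arguments idm {c}.
Bind Scope ob_scope with ob.
Bind Scope hom_scope with hom.
Notation "g ∘ f" := (compose g f) : hom_scope.
Open Scope hom_scope.

(* The monoidal structure is not assumed to be strict: the associator [assoc],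
   the unitors [lunit], [runit] and their inverses are part of the data. *)
Record symmetric_monoidal_category := SymmetricMonoidalCategory {
  smc_category :> category;
  munit : smc_category;
  tensor : smc_category -> smc_category -> smc_category
    where "X ⊗ Y" := (tensor X Y) : ob_scope;
  tensorm : forall X X' Y Y' : smc_category,
    hom X X' -> hom Y Y' -> hom (X ⊗ Y)%ob (X' ⊗ Y')%ob
    where "f ⊗ g" := (tensorm f g) : hom_scope;
  assoc : forall X Y Z, hom (X ⊗ Y ⊗ Z)%ob (X ⊗ (Y ⊗ Z))%ob;
  assocV : forall X Y Z, hom (X ⊗ (Y ⊗ Z))%ob (X ⊗ Y ⊗ Z)%ob;
  lunit : forall X, hom (munit ⊗ X)%ob X;
  lunitV : forall X, hom X (munit ⊗ X)%ob;
  runit : forall X, hom (X ⊗ munit)%ob X;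
  runitV : forall X, hom X (X ⊗ munit)%ob;
  swap : forall X Y, hom (X ⊗ Y)%ob (Y ⊗ X)%ob;
  tensorm1 : forall X Y, idm X ⊗ idm Y = idm (X ⊗ Y)%ob;
  tensorm_compose : forall X X' X'' Y Y' Y''
      (f' : hom X' X'') (f : hom X X') (g' : hom Y' Y'') (g : hom Y Y'),
    (f' ∘ f) ⊗ (g' ∘ g) = (f' ⊗ g') ∘ (f ⊗ g);
  assocK : forall X Y Z, assocV X Y Z ∘ assoc X Y Z = idm _;
  assocVK : forall X Y Z, assoc X Y Z ∘ assocV X Y Z = idm _;
  lunitK : forall X, lunitV X ∘ lunit X = idm _;
  lunitVK : forall X, lunit X ∘ lunitV X = idm _;
  runitK : forall X, runitV X ∘ runit X = idm _;
  runitVK : forall X, runit X ∘ runitV X = idm _;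
  swapK : forall X Y, swap Y X ∘ swap X Y = idm _;
  assoc_natural : forall X X' Y Y' Z Z'
      (f : hom X X') (g : hom Y Y') (h : hom Z Z'),
    assoc X' Y' Z' ∘ (f ⊗ g ⊗ h) = (f ⊗ (g ⊗ h)) ∘ assoc X Y Z;
  lunit_natural : forall X X' (f : hom X X'),
    lunit X' ∘ (idm munit ⊗ f) = f ∘ lunit X;
  runit_natural : forall X X' (f : hom X X'),
    runit X' ∘ (f ⊗ idm munit) = f ∘ runit X;
  swap_natural : forall X X' Y Y' (f : hom X X') (g : hom Y Y'),
    swap X' Y' ∘ (f ⊗ g) = (g ⊗ f) ∘ swap X Y;
  pentagon : forall W X Y Z,
    assoc W X (Y ⊗ Z)%ob ∘ assoc (W ⊗ X)%ob Y Z =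
    (idm W ⊗ assoc X Y Z) ∘ assoc W (X ⊗ Y)%ob Z ∘ (assoc W X Y ⊗ idm Z);
  triangle : forall X Y,
    (idm X ⊗ lunit Y) ∘ assoc X munit Y = runit X ⊗ idm Y;
  hexagon : forall X Y Z,
    assoc Y Z X ∘ swap X (Y ⊗ Z)%ob ∘ assoc X Y Z =
    (idm Y ⊗ swap X Z) ∘ assoc Y X Z ∘ (swap X Y ⊗ idm Z)
}.

Arguments munit {s}.
Arguments assoc {s} X Y Z.
Arguments assocV {s} X Y Z.
Arguments lunit {s} X.
Arguments lunitV {s} X.
Arguments runit {s} X.
Arguments runitV {s} X.
Arguments swap {s} X Y.
Notation "X ⊗ Y" := (tensor X Y) : ob_scope.
Notation "f ⊗ g" := (tensorm f g) : hom_scope.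

(* id ⊗ swap ⊗ id, with its coherence isomorphisms. *)
Definition middle_swap (C : symmetric_monoidal_category) (W X Y Z : C) :
    hom ((W ⊗ X) ⊗ (Y ⊗ Z)) ((W ⊗ Y) ⊗ (X ⊗ Z)) :=
  assocV W Y (X ⊗ Z)
    ∘ (idm W ⊗ (assoc Y X Z ∘ (swap X Y ⊗ idm Z) ∘ assocV X Y Z))
    ∘ assoc W X (Y ⊗ Z).

Record markov_category := MarkovCategory {
  markov_smc :> symmetric_monoidal_category;
  copy : forall X : markov_smc, hom X (X ⊗ X);
  del : forall X : markov_smc, hom X munit;
  del_terminal : forall X (f : hom X munit), f = del X;
  copy_assoc : forall X,
    assoc X X X ∘ (copy X ⊗ idm X) ∘ copy X = (idm X ⊗ copy X) ∘ copy X;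
  copy_counitl : forall X, lunit X ∘ (del X ⊗ idm X) ∘ copy X = idm X;
  copy_counitr : forall X, runit X ∘ (idm X ⊗ del X) ∘ copy X = idm X;
  copy_comm : forall X, swap X X ∘ copy X = copy X;
  copy_tensor : forall X Y,
    copy (X ⊗ Y) = middle_swap X X Y Y ∘ (copy X ⊗ copy Y)
}.

Arguments copy {m} X.
Arguments del {m} X.

Section MarkovCategories.
Variable C : markov_category.
Implicit Types A B X Y Θ : C.

Definition deterministic X Y (f : hom X Y) : Prop :=
  copy Y ∘ f = (f ⊗ f) ∘ copy X.

Lemma deterministic_idm X : deterministic (idm X).
Proof. by rewrite /deterministic composem1 tensorm1 compose1m. Qed.

Lemma deterministic_compose X Y Z (g : hom Y Z) (f : hom X Y) :
  deterministic g -> deterministic f -> deterministic (g ∘ f).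
Proof.
rewrite /deterministic => dg df.
by rewrite composeA dg -composeA df composeA -tensorm_compose.
Qed.

Definition marginall A X Y (f : hom A (X ⊗ Y)) : hom A X :=
  runit X ∘ (idm X ⊗ del Y) ∘ f.

Definition is_conditional A X Y
    (f : hom A (X ⊗ Y)) (fX : hom (X ⊗ A) Y) : Prop :=
  f = (idm X ⊗ fX) ∘ assoc X X A ∘ (copy X ⊗ idm A)
        ∘ (marginall f ⊗ idm A) ∘ copy A.

Definition has_conditionals : Prop :=
  forall A X Y (f : hom A (X ⊗ Y)), exists fX, is_conditional f fX.

Definition is_bayesian_inverse Θ X
    (m : hom munit Θ) (f : hom Θ X) (fd : hom X Θ) : Prop :=
  (f ⊗ idm Θ) ∘ copy Θ ∘ m = (idm X ⊗ fd) ∘ copy X ∘ f ∘ m.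

Definition as_eq A X Y (h : hom A X) (f g : hom X Y) : Prop :=
  (idm X ⊗ f) ∘ copy X ∘ h = (idm X ⊗ g) ∘ copy X ∘ h.

(* A choice of a distribution object for every object; [sharp] is the inverse
   of the map [samp X ∘ -] from deterministic morphisms [A -> dist X] to
   arbitrary morphisms [A -> X]. *)
Record representation := Representation {
  dist : C -> C;
  samp : forall X, hom (dist X) X;
  sharp : forall A X, hom A X -> hom A (dist X);
  sharp_deterministic : forall A X (f : hom A X), deterministic (sharp f);
  samp_sharp : forall A X (f : hom A X), samp X ∘ sharp f = f;
  sharp_samp : forall A X (g : hom A (dist X)),
    deterministic g -> sharp (samp X ∘ g) = g
}.

Variable P : representation.

Definition as_compatible : Prop :=
  forall A B X (p : hom B A) (f g : hom A X),
    as_eq p (sharp P f) (sharp P g) <-> as_eq p f g.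

Definition dist_map X Y (f : hom X Y) : hom (dist P X) (dist P Y) :=
  sharp P (f ∘ samp P X).

Lemma dist_map_deterministic X Y (f : hom X Y) : deterministic (dist_map f).
Proof. exact: sharp_deterministic. Qed.

Lemma dist_map_idm X : dist_map (idm X) = idm (dist P X).
Proof.
rewrite /dist_map compose1m -[samp P X]composem1.
by rewrite sharp_samp //; apply: deterministic_idm.
Qed.

Lemma dist_map_compose X Y Z (g : hom Y Z) (f : hom X Y) :
  dist_map (g ∘ f) = dist_map g ∘ dist_map f.
Proof.
rewrite -[RHS]sharp_samp; last first.
  by apply: deterministic_compose; apply: dist_map_deterministic.
by rewrite composeA samp_sharp -composeA samp_sharp composeA.
Qed.

(* [fd] stands for the chosen Bayesian inverse of [f]. *)
Definition standard_experiment Θ X (f : hom Θ X) (fd : hom X Θ) :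
    hom Θ (dist P Θ) :=
  sharp P fd ∘ f.

Definition standard_measure Θ X
    (m : hom munit Θ) (f : hom Θ X) (fd : hom X Θ) : hom munit (dist P Θ) :=
  standard_experiment f fd ∘ m.

Definition is_dilation Θ
    (q : hom munit (dist P Θ)) (t : hom (dist P Θ) (dist P Θ)) : Prop :=
  as_eq q (dist_map (samp P Θ) ∘ sharp P t) (idm (dist P Θ)).

Definition second_order_dominates Θ (q p : hom munit (dist P Θ)) : Prop :=
  exists t : hom (dist P Θ) (dist P Θ), is_dilation q t /\ p = t ∘ q.

Definition as_more_informative Θ X Y
    (m : hom munit Θ) (f : hom Θ X) (g : hom Θ Y) : Prop :=
  exists c : hom X Y, as_eq m (c ∘ f) g.

End MarkovCategories.

(* Main.v *)
(* A Bayesian inverse exchanges the two sides of a joint state.  The samp map is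
   a Bayesian inverse of [ĝ], and by a.s.-compatibility [t] is a
   [ĝ_m]-dilation exactly when [samp ∘ t] is [ĝ_m]-a.s. equal to [samp].
   From [c] with [c ∘ f = g] [m]-a.s. one obtains the dilation [t = fd^♯ ∘ k], where [k]
   is a Bayesian inverse of [gd^♯ ∘ c]; from a dilation [t], a Bayesian inverse
   of [t] turns [f̂] into [ĝ], and a Bayesian inverse of [gd^♯] turns [ĝ] back
   into [g]. *)
From mathcomp Require Import ssreflect.
Require Import Defs.

Set Implicit Arguments.
Unset Strict Implicit.
Unset Printing Implicit Defensive.

Section Coherence.
Variable C : symmetric_monoidal_category.
Implicit Types X Y : C.

(** By naturality of [runit], tensoring with the unit is conjugation by an isomorphism. *)
Lemma tensorm_unitr_inj X Y (f g : hom X Y) :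
  f ⊗ idm munit = g ⊗ idm munit -> f = g.
Proof.
move=> fg; rewrite -[f]composem1 -[g]composem1 -(runitVK X) !composeA.
by rewrite -!runit_natural fg.
Qed.

Lemma runitV_natural X Y (f : hom X Y) :
  (f ⊗ idm munit) ∘ runitV X = runitV Y ∘ f.
Proof.
rewrite -[LHS]compose1m -runitK -!composeA [runit Y ∘ _]composeA.
by rewrite runit_natural -composeA runitVK composem1.
Qed.

(* Kelly's argument: the equation holds after tensoring with the unit on the
   right and composing with the associator, by the pentagon and triangle. *)
Lemma runit_tensor X Y : (idm X ⊗ runit Y) ∘ assoc X Y munit = runit (X ⊗ Y).
Proof.
apply: tensorm_unitr_inj.
rewrite -[LHS]compose1m -[RHS]compose1m -assocK -!composeA; congr (_ ∘ _).
rewrite -[idm munit in LHS]compose1m tensorm_compose composeA assoc_natural.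
rewrite -triangle -{1}[idm X]compose1m tensorm_compose.
rewrite -triangle composeA -tensorm1 assoc_natural -[in RHS]composeA pentagon.
by rewrite !composeA.
Qed.

Lemma assoc_runitV X Y : assoc X Y munit ∘ runitV (X ⊗ Y) = idm X ⊗ runitV Y.
Proof.
rewrite -[LHS]compose1m -tensorm1 -(runitK Y) -{1}[idm X]compose1m.
rewrite tensorm_compose -composeA [(_ ⊗ runit Y) ∘ _]composeA runit_tensor.
by rewrite runitVK composem1.
Qed.

End Coherence.

Section MarkovCategories.
Variable C : markov_category.
Implicit Types A B X Y Z Θ : C.

(** An [as_eq] is by conversion an equality of two [joint]s with left leg [idm], so the lemmas on
    [joint] apply to it directly. *)
Definition joint A X Y Z (p : hom A X) (u : hom X Y) (v : hom X Z) :
    hom A (Y ⊗ Z) :=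
  (u ⊗ v) ∘ copy X ∘ p.

Lemma tensorm_joint A X Y Z Y' Z' (p : hom A X) (u : hom X Y) (v : hom X Z)
    (a : hom Y Y') (b : hom Z Z') :
  (a ⊗ b) ∘ joint p u v = joint p (a ∘ u) (b ∘ v).
Proof. by rewrite /joint tensorm_compose !composeA. Qed.

Lemma joint_map A X X' Y Z Y' Z' (p : hom A X) (q : hom A X')
    (u : hom X Y) (v : hom X Z) (u' : hom X' Y) (v' : hom X' Z)
    (a : hom Y Y') (b : hom Z Z') :
  joint p u v = joint q u' v' ->
  joint p (a ∘ u) (b ∘ v) = joint q (a ∘ u') (b ∘ v').
Proof. by move=> e; rewrite -!tensorm_joint e. Qed.

Lemma swap_joint A X Y Z (p : hom A X) (u : hom X Y) (v : hom X Z) :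
  swap Y Z ∘ joint p u v = joint p v u.
Proof.
by rewrite /joint !composeA swap_natural -[_ ∘ swap X X ∘ _]composeA copy_comm.
Qed.

Lemma joint_sym A X X' Y Z (p : hom A X) (q : hom A X')
    (u : hom X Y) (v : hom X Z) (u' : hom X' Y) (v' : hom X' Z) :
  joint p u v = joint q u' v' -> joint p v u = joint q v' u'.
Proof. by move=> e; rewrite -!(swap_joint _ u) -!(swap_joint _ u') e. Qed.

Lemma joint_deterministic A B X Y Z (d : hom B X) (p : hom A B)
    (u : hom X Y) (v : hom X Z) :
  deterministic d -> joint (d ∘ p) u v = joint p (u ∘ d) (v ∘ d).
Proof.
move=> dd; rewrite /joint tensorm_compose composeA.
by rewrite -[_ ∘ copy X ∘ d]composeA dd !composeA.
Qed.

(** By terminality [v] disappears under [del], which leaves the counit law. *)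
Lemma marginall_joint A X Y Z (p : hom A X) (u : hom X Y) (v : hom X Z) :
  marginall (joint p u v) = u ∘ p.
Proof.
rewrite /marginall -composeA tensorm_joint compose1m (del_terminal (_ ∘ v)).
rewrite -{1}[u]composem1 -[del X]compose1m -tensorm_joint composeA.
rewrite runit_natural -composeA; congr (_ ∘ _).
by rewrite /joint !composeA copy_counitr compose1m.
Qed.

Lemma as_eq_compose A X Y (h : hom A X) (u v : hom X Y) :
  as_eq h u v -> u ∘ h = v ∘ h.
Proof.
by move=> /joint_sym uv; rewrite -(marginall_joint h u (idm X)) uv marginall_joint.
Qed.

Lemma as_eq_joint A X Y Z (h : hom A X) (u v : hom X Y) (w : hom X Z) :
  as_eq h u v -> joint h w u = joint h w v.
Proof.
by move=> /(@joint_map _ _ _ _ _ _ _ _ _ _ _ _ _ w (idm Y)); rewrite composem1 !compose1m.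
Qed.

Lemma bayesian_inverse_joint Θ X (m : hom munit Θ) (f : hom Θ X)
    (fd : hom X Θ) :
  is_bayesian_inverse m f fd <-> joint m f (idm Θ) = joint (f ∘ m) (idm X) fd.
Proof. by rewrite /is_bayesian_inverse /joint !composeA. Qed.

(** On the unit [del] is the identity, so the counit law makes [copy munit] a section of the
    isomorphism [runit munit]. *)
Lemma copy_munit : copy munit = runitV munit :> hom munit (munit ⊗ munit : C).
Proof.
rewrite -[LHS]compose1m -runitK -{2}[runitV munit]composem1 -composeA.
congr (_ ∘ _).
rewrite -[RHS]copy_counitr -(del_terminal (idm munit)) tensorm1.
by rewrite composem1.
Qed.

(** The inverse is a conditional of the joint state of [f] and [idm Θ] with respect to [X]; [runitV]
    supplies its trivial input. *)
Lemma has_bayesian_inverse Θ X (m : hom munit Θ) (f : hom Θ X) :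
  has_conditionals C -> exists fd, is_bayesian_inverse m f fd.
Proof.
move=> /(_ _ _ _ (joint m f (idm Θ))) [h hP].
exists (h ∘ runitV X); apply/bayesian_inverse_joint.
rewrite {}hP marginall_joint; set p := f ∘ m.
rewrite copy_munit -composeA runitV_natural.
rewrite composeA -[_ ∘ (copy X ⊗ _) ∘ _]composeA runitV_natural composeA.
rewrite -[_ ∘ assoc X X _ ∘ _]composeA assoc_runitV -tensorm_compose.
by rewrite compose1m.
Qed.

Variable P : representation C.

(** Being deterministic, [sharp P fd] passes through [copy], and [samp] then cancels it, leaving the
    equation of [fd]. *)
Lemma samp_bayesian_inverse Θ X (m : hom munit Θ) (f : hom Θ X)
    (fd : hom X Θ) :
  is_bayesian_inverse m f fd ->
  is_bayesian_inverse m (standard_experiment P f fd) (samp P Θ).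
Proof.
move=> /bayesian_inverse_joint fdP; apply/bayesian_inverse_joint.
rewrite /standard_experiment -composeA joint_deterministic; last first.
  exact: sharp_deterministic.
rewrite samp_sharp compose1m.
have := joint_map (sharp P fd) (idm Θ) fdP.
by rewrite !compose1m composem1.
Qed.

(** Both morphisms compared in a dilation are deterministic, hence of the form [sharp P u], and
    a.s.-compatibility strips the [sharp]. *)
Lemma is_dilationE Θ (q : hom munit (dist P Θ))
    (t : hom (dist P Θ) (dist P Θ)) :
  as_compatible P -> is_dilation q t <-> as_eq q (samp P Θ ∘ t) (samp P Θ).
Proof.
move=> Pcompat; apply: iff_trans (Pcompat _ _ _ _ _ _).
suff e : dist_map P (samp P Θ) ∘ sharp P t = sharp P (samp P Θ ∘ t).
  rewrite /is_dilation e -(sharp_samp (deterministic_idm (dist P Θ))).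
  by rewrite composem1.
rewrite -[LHS]sharp_samp; last first.
  by apply: deterministic_compose; apply: sharp_deterministic.
by rewrite composeA samp_sharp -composeA samp_sharp.
Qed.

(** A Bayesian inverse of [sharp P fd] recovers [f]: moving it to the other leg turns [samp] into
    [samp P Θ ∘ sharp P fd], which is [fd]. *)
Lemma standard_experiment_informative Θ X (m : hom munit Θ) (f : hom Θ X)
    (fd : hom X Θ) :
  has_conditionals C -> is_bayesian_inverse m f fd ->
  as_more_informative m (standard_experiment P f fd) f.
Proof.
move=> Ccond fdP.
have [k /bayesian_inverse_joint kP] :=
  has_bayesian_inverse (f ∘ m) (sharp P fd) Ccond.
exists k; apply: joint_sym.
have /bayesian_inverse_joint sP := samp_bayesian_inverse fdP.
have := joint_map k (idm Θ) sP; rewrite !compose1m => ->.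
have := joint_map (samp P Θ) (idm X) (eq_sym kP).
rewrite composem1 !compose1m samp_sharp composem1 /standard_experiment -composeA.
move/joint_sym => ->.
by move/bayesian_inverse_joint: fdP => ->.
Qed.

Lemma dominates_of_informative Θ X Y (m : hom munit Θ) (f : hom Θ X)
    (g : hom Θ Y) (fd : hom X Θ) (gd : hom Y Θ) :
  as_compatible P -> has_conditionals C ->
  is_bayesian_inverse m f fd -> is_bayesian_inverse m g gd ->
  as_more_informative m f g ->
  second_order_dominates (standard_measure P m g gd)
                         (standard_measure P m f fd).
Proof.
move=> Pcompat Ccond /bayesian_inverse_joint fdP gdP [c cfg].
have [k /bayesian_inverse_joint kP] :=
  has_bayesian_inverse (f ∘ m) (sharp P gd ∘ c) Ccond.
have gmE : sharp P gd ∘ c ∘ (f ∘ m) = standard_measure P m g gd.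
  rewrite -composeA [c ∘ _]composeA (as_eq_compose cfg).
  by rewrite /standard_measure /standard_experiment composeA.
rewrite gmE in kP.
exists (sharp P fd ∘ k); split; last first.
  (* The second marginal of [kP] says that [k] sends [ĝ_m] to [f ∘ m]. *)
  have := f_equal (@marginall _ _ _ _) (joint_sym kP).
  rewrite !marginall_joint compose1m -composeA => <-.
  by rewrite /standard_measure /standard_experiment composeA.
apply/is_dilationE => //; rewrite composeA samp_sharp.
(* Both sides equal [joint m ĝ (idm Θ)]: on the left, [k] and then [fd] are inverted, and [cfg]
   replaces [c ∘ f] by [g]. *)
change (joint (standard_measure P m g gd) (idm _) (fd ∘ k) =
        joint (standard_measure P m g gd) (idm _) (samp P Θ)).
have := joint_map (idm _) fd (eq_sym kP); rewrite !compose1m composem1 => ->.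
have := joint_map (sharp P gd ∘ c) (idm Θ) (eq_sym fdP).
rewrite !compose1m composem1 => ->.
have /bayesian_inverse_joint sP := samp_bayesian_inverse gdP.
rewrite -[RHS]sP /standard_experiment -composeA.
have := joint_map (sharp P gd) (idm Θ) (joint_sym cfg).
by rewrite !compose1m.
Qed.

Lemma informative_of_dominates Θ X Y (m : hom munit Θ) (f : hom Θ X)
    (g : hom Θ Y) (fd : hom X Θ) (gd : hom Y Θ) :
  as_compatible P -> has_conditionals C ->
  is_bayesian_inverse m f fd -> is_bayesian_inverse m g gd ->
  second_order_dominates (standard_measure P m g gd)
                         (standard_measure P m f fd) ->
  as_more_informative m f g.
Proof.
move=> Pcompat Ccond fdP gdP [t [/(is_dilationE _ _ Pcompat) tdil tE]].
have [k kP] := standard_experiment_informative Ccond gdP.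
have [s /bayesian_inverse_joint sP] :=
  has_bayesian_inverse (standard_measure P m g gd) t Ccond.
rewrite -tE in sP.
have /bayesian_inverse_joint fP := samp_bayesian_inverse fdP.
have /bayesian_inverse_joint gP := samp_bayesian_inverse gdP.
(* Inverting [samp] and then [s] produces [samp P Θ ∘ t] under [ĝ_m], where the dilation property
   removes [t]. *)
have sfg : joint m (s ∘ standard_experiment P f fd) (idm Θ) =
           joint m (standard_experiment P g gd) (idm Θ).
  have := joint_map s (idm Θ) fP; rewrite !compose1m composem1 => ->.
  have := joint_map (samp P Θ) (idm _) (eq_sym sP).
  rewrite !compose1m composem1 => /joint_sym ->.
  by rewrite (as_eq_joint (idm _) tdil) gP.
(* An outcome of [f] goes to its posterior, then by [s] to a posterior for [g], from which [k] draws
   an outcome of [g]. *)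
exists (k ∘ s ∘ sharp P fd).
have := joint_map k (idm Θ) sfg; rewrite compose1m => /joint_sym kE.
rewrite /as_eq -[RHS]kP; move: kE.
by rewrite /joint /standard_experiment !composeA.
Qed.

End MarkovCategories.

Theorem theorem5p13 (C : markov_category) (P : representation C)
    (Pcompat : as_compatible P) (Ccond : has_conditionals C)
    (Θ X Y : C) (m : hom munit Θ) (f : hom Θ X) (g : hom Θ Y)
    (fd : hom X Θ) (fdP : is_bayesian_inverse m f fd)
    (gd : hom Y Θ) (gdP : is_bayesian_inverse m g gd) :
  as_more_informative m f g <->
  second_order_dominates (standard_measure P m g gd)
                         (standard_measure P m f fd).
Proof.
split; first exact: dominates_of_informative.
exact: informative_of_dominates.
Qed.
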